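(* For every real $x$ and every integer $n\ge 0$, $$D_{n,\lambda}^{Y}(x)=\sum_{j=0}^{n}\sum_{l=0}^{j}\binom{n}{j}{j \brack l}_{\lambda}(-1)^{n-j}\langle 1\rangle_{l,\lambda}\,E\big[\langle Y\rangle_{n-j,\lambda}\big]x^{j}.$$
   Context: Let $\lambda$ be a nonzero real number. Set $(x)_{0,\lambda}=1$, $(x)_{k,\lambda}=x(x-\lambda)\cdots(x-(k-1)\lambda)$ and $\langle x\rangle_{0,\lambda}=1$, $\langle x\rangle_{k,\lambda}=x(x+\lambda)\cdots(x+(k-1)\lambda)$ for $k\ge 1$. The degenerate exponential is $e_{\lambda}^{x}(t)=\sum_{k\ge 0}(x)_{k,\lambda}\frac{t^{k}}{k!}$, $e_\lambda(t)=e_\lambda^1(t)$ (so $e_\lambda^x(t)=(1+\lambda t)^{x/\lambda}$ for $t$ near $0$). Let $\log_\lambda(t)$ be the compositional inverse of $e_\lambda(t)$, i.e. $\log_\lambda(e_\lambda(t))=e_\lambda(\log_\lambda(t))=t$; explicitly $\log_\lambda(1+t)=\frac{(1+t)^{\lambda}-1}{\lambda}$. The unsigned degenerate Stirling numbers of the first kind ${j\brack l}_{\lambda}$ are given by $$\frac{(-1)^{l}}{l!}\big(\log_{\lambda}(1-t)\big)^{l}=\sum_{j=l}^{\infty}{j\brack l}_{\lambda}\frac{t^{j}}{j!}\quad(l\ge 0).$$ $Y$ is a real random variable whose moment generating function $E[e^{tY}]=\sum_{n\ge 0}E[Y^n]\frac{t^n}{n!}$ exists for $|t|<r$, for some $r>0$.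 $E$ denotes expectation. The probabilistic degenerate derangement polynomials of the second kind associated with $Y$, $D_{n,\lambda}^{Y}(x)$, are defined by $$\frac{1}{1-xt}E\big[e_{\lambda}^{-Y}(t)\big]=\sum_{n=0}^{\infty}D_{n,\lambda}^{Y}(x)\frac{t^{n}}{n!}$$ (all power series in $t$ near $0$). Convention: $x^0=1$ for all $x$. *)

(* Defs.v *)
From HB Require Import structures.
From mathcomp Require Import all_boot all_order all_algebra.
From mathcomp Require Import all_classical all_reals all_analysis.

Set Implicit Arguments.
Unset Strict Implicit.
Unset Printing Implicit Defensive.
Import Order.TTheory GRing.Theory Num.Theory.
Import numFieldNormedType.Exports.

Local Open Scope classical_set_scope.
Local Open Scope ring_scope.

(* (x)_{k,lam} = x (x - lam) ... (x - (k-1) lam) *)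
Definition degen_falling (R : realType) (lam x : R) (k : nat) : R :=
  \prod_(i < k) (x - i%:R * lam).

(* <x>_{k,lam} = x (x + lam) ... (x + (k-1) lam) *)
Definition degen_rising (R : realType) (lam x : R) (k : nat) : R :=
  \prod_(i < k) (x + i%:R * lam).

(* e_lam^x(t); the limit is meaningful where the series converges, in
   particular for |lam * t| < 1 *)
Definition degen_exp (R : realType) (lam x t : R) : R :=
  limn (series (fun k : nat => degen_falling lam x k * (t ^+ k / k`!%:R))).

(* log_lam, the compositional inverse of e_lam = e_lam^1. The restriction to
   the disc |lam * s| < 1 selects the branch with log_lam(1) = 0: when 1 / lam
   is a natural number the series defining e_lam is a polynomial, which need
   not be injective on the whole line. *)
Definition degen_log (R : realType) (lam u : R) : R :=
  get [set s : R | `|lam * s| < 1 /\ degen_exp lam 1 s = u].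

(* F(t) = \sum_(k >= m) a_k t^k / k! for t near 0, with a_k = 0 for k < m *)
Definition is_egf (R : realType) (m : nat) (F : R -> R) (a : nat -> R) : Prop :=
  (forall k : nat, (k < m)%N -> a k = 0) /\
  \forall t \near (0 : R),
    (fun n : nat => \sum_(m <= k < n) a k * (t ^+ k / k`!%:R)) @ \oo --> F t.

(* The coefficient sequence is unique when it exists; it is the constant
   default of [get] when F has no such expansion. *)
Definition egf_coef (R : realType) (m : nat) (F : R -> R) : nat -> R :=
  get [set a : nat -> R | is_egf m F a].

(* unsigned degenerate Stirling numbers of the first kind [j brack l]_lam *)
Definition degen_stirling1 (R : realType) (lam : R) (j l : nat) : R :=
  egf_coef l
    (fun t : R => (-1) ^+ l / l`!%:R * degen_log lam (1 - t) ^+ l) j.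

(* probabilistic degenerate derangement polynomials of the second kind
   D_{n,lam}^Y(x) *)
Definition prob_degen_derangement (R : realType) (d : measure_display)
    (T : measurableType d) (P : probability T R) (lam : R) (Y : {RV P >-> R})
    (n : nat) (x : R) : R :=
  egf_coef 0
    (fun t : R => (1 - x * t)^-1 *
       fine ('E_P[fun w : T => degen_exp lam (- Y w) t])%E) n.

(* Main.v *)
Require Import Defs.
From HB Require Import structures.
From mathcomp Require Import all_boot all_order all_algebra.
From mathcomp Require Import all_classical all_reals all_analysis.
From mathcomp Require Import measurable_realfun ring lra.
Import Order.TTheory GRing.Theory Num.Theory.
Import numFieldNormedType.Exports.
Local Open Scope classical_set_scope.
Local Open Scope ring_scope.
Set Implicit Arguments.
Unset Strict Implicit.
Unset Printing Implicit Defensive.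

(** The proof compares Taylor coefficients at 0. Two facts make the identity
    true.

    - Since the moment generating function of Y is finite on |t| < r, for small
      t the partial sums of the series of e_lam^(-Y)(t) are dominated by a
      multiple of cosh(r Y / 2), which is integrable. Hence the expectation can
      be taken term by term ([is_egf_expectation_degen_exp]), and
      (-Y)_{k,lam} = (-1)^k <Y>_{k,lam}. Multiplying by the geometric series
      1 / (1 - x t) ([is_egf_geometric_mul]) gives
      D_n(x) = \sum_j C(n,j) j! x^j (-1)^(n-j) E<Y>_{n-j,lam}.

    - The factor j! is \sum_(l <= j) [j, l]_lam <1>_{l,lam}
      ([sum_stirling1_rising]): this is the expansion of
      1 / (1 - t) = e_lam^(-1)(log_lam(1 - t)) in powers of -log_lam(1 - t).

    Substituting the second formula into the first gives the theorem.

    No composition of power series is carried out for the second fact. Near 0,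
    log_lam(1 - t) is ((1 - t)^lam - 1) / lam, so the binomial theorem turns its
    l-th power into a finite combination of the powers (1 - t)^(i lam), each of
    which is a binomial series. This yields a closed formula for the Stirling
    numbers, from which the recurrence
    [j+1, l+1] = (j - (l+1) lam) [j, l+1] + [j, l] follows, and the sum over l
    is then computed by induction on j.

    The analytic inputs are the binomial series
    e_lam^y(t) = (1 + lam t)^(y / lam) on |lam t| < 1 ([degen_exp_powR]), and the
    uniqueness of the coefficients of a power series ([egf_coefE]), which turns
    the coefficients extracted by choice into the explicit sequences above. *)

(** * The binomial series *)

(** Beyond some rank the terms decrease at least geometrically; the finitely
    many earlier ones are absorbed into the constant of a dominating geometric
    sequence. *)
Lemma ratio_test (R : realType) (u : R^nat) (rho : R) :
  (forall k, 0 <= u k) -> 0 < rho < 1 ->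
  (\forall k \near \oo, u k.+1 <= rho * u k) -> cvgn (series u).
Proof.
move=> u_ge0 /andP[rho_gt0 rho_lt1] [N _ ratio].
(* Each earlier term contributes to M, so that the bound holds from rank 0. *)
pose M := \sum_(i < N.+1) u i / rho ^+ i.
have term_ge0 i : 0 <= u i / rho ^+ i by rewrite divr_ge0// exprn_ge0// ltW.
have dominated k : u k <= M * rho ^+ k.
  elim: k => [|k IHk].
    rewrite expr0 mulr1 /M (bigD1 ord0)//= expr0 divr1 lerDl.
    exact: sumr_ge0.
  case: (leqP N k) => [Nk|kN].
    apply: (le_trans (ratio _ Nk)); rewrite exprS mulrCA.
    by rewrite ler_pM2l.
  rewrite -ler_pdivrMr ?exprn_gt0//.
  have kN' : (k.+1 < N.+1)%N by [].
  by rewrite /M (bigD1 (Ordinal kN'))//= lerDl; exact: sumr_ge0.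
apply: (@series_le_cvg _ _ (geometric M rho)) => //.
  by move=> k; exact: le_trans (u_ge0 k) (dominated k).
by apply: is_cvg_geometric_series; rewrite gtr0_norm.
Qed.

Definition degen_coef (R : realType) (lam y : R) (k : nat) : R :=
  degen_falling lam y k / k`!%:R.

Section DegenerateExponential.
Variable R : realType.
Implicit Types lam y t : R.

Lemma degen_fallingS lam y k :
  degen_falling lam y k.+1 = degen_falling lam y k * (y - k%:R * lam).
Proof. by rewrite /degen_falling big_ord_recr. Qed.

Lemma degen_fallingSl lam y k :
  degen_falling lam y k.+1 = y * degen_falling lam (y - lam) k.
Proof.
rewrite /degen_falling big_ord_recl mul0r subr0; congr (_ * _).
by apply: eq_bigr => i _; rewrite -addrA -opprD /= /bump /= natrD mulrDl mul1r.
Qed.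

Lemma degen_coefS lam y k :
  degen_coef lam y k.+1 = degen_coef lam y k * ((y - k%:R * lam) / k.+1%:R).
Proof.
rewrite /degen_coef degen_fallingS factS natrM invfM.
by rewrite [in LHS](mulrC (_ ^-1)) !mulrA; congr (_ * _); rewrite mulrAC.
Qed.

Lemma is_cvg_degen_coef_norm lam y t : `|lam * t| < 1 ->
  cvgn (series (fun k => `|degen_coef lam y k * t ^+ k|)).
Proof.
move=> lamt_lt1; set q := `|lam * t|; pose rho := (1 + q) / 2.
have q_ge0 : 0 <= q by exact: normr_ge0.
have q_lt1 : q < 1 by [].
have rho_q : 0 < rho - q by rewrite /rho; lra.
apply: (@ratio_test _ _ rho) => [k||]; first exact: normr_ge0.
  by rewrite /rho; apply/andP; split; lra.
near=> k.
rewrite degen_coefS exprS mulrACA (mulrC _ t) mulrA.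
rewrite (_ : _ * _ * _ * _ = (degen_coef lam y k * t ^+ k) *
  (t * ((y - k%:R * lam) / k.+1%:R))); last by ring.
rewrite normrM mulrC ler_wpM2r ?normr_ge0// mulrA normrM normfV.
rewrite (ger0_norm (ler0n _ _)) ler_pdivrMr ?ltr0n//.
have : `|y * t| <= (rho - q) * k%:R.
  rewrite [leRHS]mulrC -ler_pdivrMr//; near: k; exact: nbhs_infty_ger.
rewrite -[k.+1]addn1 natrD => yt_le.
rewrite (_ : t * _ = y * t - k%:R * (lam * t)); last by ring.
apply: (le_trans (ler_normB _ _)); rewrite (normrM k%:R) (ger0_norm (ler0n _ _)).
rewrite -/q; have : 0 <= rho by rewrite /rho; lra.
by nra.
Unshelve. all: by end_near. Qed.

Lemma is_cvg_degen_coef lam y t : `|lam * t| < 1 ->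
  cvgn (pseries (degen_coef lam y) t).
Proof. by move=> h; apply: normed_cvg; exact: is_cvg_degen_coef_norm. Qed.

Lemma degen_expE lam y t : degen_exp lam y t = limn (pseries (degen_coef lam y) t).
Proof.
rewrite /degen_exp /pseries; congr (limn (series _)).
by apply/funext => k; rewrite /degen_coef mulrA mulrAC.
Qed.

(** At the level of coefficients, the derivative of e_lam^y is
    y e_lam^(y - lam): the family over y is stable under differentiation, so
    convergence for every y also gives convergence of all derivatives. *)
Lemma pseries_diffs_degen_coef lam y :
  pseries_diffs (degen_coef lam y) = (fun k => y * degen_coef lam (y - lam) k).
Proof.
apply/funext => k; rewrite /pseries_diffs /degen_coef degen_fallingSl factS natrM.
by field; rewrite pnatr_eq0 -lt0n fact_gt0 nat1r pnatr_eq0.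
Qed.

Lemma cvg_pseriesZ (f : R^nat) c t l :
  pseries f t @ \oo --> l -> pseries (fun k => c * f k) t @ \oo --> c * l.
Proof.
move=> fl; rewrite (_ : pseries _ t = (fun n => c * pseries f t n)).
  exact: cvgMl_tmp.
apply/funext => n; rewrite /pseries /series/= mulr_sumr.
by apply: eq_bigr => k _; rewrite mulrA.
Qed.

Lemma is_derive_degen_exp lam y t : lam != 0 -> `|lam * t| < 1 ->
  is_derive t (1 : R) (degen_exp lam y) (y * degen_exp lam (y - lam) t).
Proof.
move=> lam0 lamt_lt1.
have cvgZ c y' K : `|lam * K| < 1 ->
    cvgn (pseries (fun k => c * degen_coef lam y' k) K).
  by move=> K1; apply/cvgP/cvg_pseriesZ/is_cvg_degen_coef.
(* Any radius strictly between |t| and the radius of convergence would do. *)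
pose K := (`|t| + `|lam|^-1) / 2.
have lam_gt0 : 0 < `|lam| by rewrite normr_gt0.
have t_lt : `|t| < `|lam|^-1 by rewrite -[ltRHS]mul1r ltr_pdivlMr// mulrC -normrM.
have K_gt0 : 0 < K by rewrite /K divr_gt0// ltr_wpDl// invr_gt0.
have K1 : `|lam * K| < 1.
  by rewrite normrM (gtr0_norm K_gt0) mulrC -ltr_pdivlMr// mul1r /K; lra.
have diffs_cvg : cvgn (pseries (pseries_diffs (pseries_diffs (degen_coef lam y))) K).
  rewrite pseries_diffs_degen_coef (_ : pseries_diffs _ =
    fun k => (y * (y - lam)) * degen_coef lam (y - lam - lam) k); last first.
    apply/funext => k; rewrite /pseries_diffs mulrCA -mulrA; congr (_ * _).
    by have := congr1 (@^~ k) (pseries_diffs_degen_coef lam (y - lam)).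
  exact: cvgZ.
have diff_cvg : cvgn (pseries (pseries_diffs (degen_coef lam y)) K).
  by rewrite pseries_diffs_degen_coef; exact: cvgZ.
have t_ltK : `|t| < `|K| by rewrite (gtr0_norm K_gt0) /K; lra.
have := @pseries_snd_diffs R (degen_coef lam y) K t
  (@is_cvg_degen_coef lam y K K1) diff_cvg diffs_cvg t_ltK.
rewrite pseries_diffs_degen_coef.
have cvg_t := @is_cvg_degen_coef lam (y - lam) t lamt_lt1.
rewrite (cvg_lim _ (cvg_pseriesZ (c := y) cvg_t))//.
rewrite -degen_expE (_ : degen_exp lam y =
  (fun x => limn (pseries (degen_coef lam y) x)))//.
by apply/funext => x; exact: degen_expE.
Qed.

(** Pascal's rule for the degenerate binomial coefficients. Together with the
    derivative formula it is the differential equation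
    (1 + lam t) F' = y F satisfied by (1 + lam t)^(y / lam). *)
Lemma degen_exp_pascal lam y t : `|lam * t| < 1 ->
  (1 + lam * t) * degen_exp lam (y - lam) t = degen_exp lam y t.
Proof.
move=> lamt_lt1; rewrite !degen_expE.
set s := pseries _ t; set s' := pseries (degen_coef lam y) t.
have cs : cvgn s by exact: is_cvg_degen_coef.
suff cs' : s' @ \oo --> (1 + lam * t) * limn s by rewrite (cvg_lim _ cs').
rewrite -cvg_shiftS /= mulrDl mul1r.
rewrite (_ : (fun n => s' n.+1) = (fun n => s n.+1 + (lam * t) * s n)).
  apply: cvgD; first by rewrite cvg_shiftS.
  exact: cvgMl_tmp.
apply/funext => n; rewrite /s' /s /pseries /series/= !big_nat_recl//=.
rewrite mulr_sumr -addrA -big_split/=; congr (_ + _).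
  by rewrite /degen_coef /degen_falling !big_ord0.
apply: eq_bigr => k _.
have -> : degen_coef lam y k.+1 = degen_coef lam (y - lam) k.+1
    + lam * degen_coef lam (y - lam) k.
  rewrite (degen_coefS lam (y - lam)) /degen_coef degen_fallingSl factS natrM.
  by field; rewrite pnatr_eq0 -lt0n fact_gt0 nat1r pnatr_eq0.
by rewrite exprS; ring.
Qed.

(** The quotient of the series by the power has derivative zero along the
    segment from 0 to t, hence keeps its value 1 at 0. *)
Lemma degen_exp_powR lam y t : lam != 0 -> `|lam * t| < 1 ->
  degen_exp lam y t = (1 + lam * t) `^ (y / lam).
Proof.
move=> lam0 lamt_lt1.
have seg_lt1 (s : R) : 0 <= s <= 1 -> `|lam * (t * s)| < 1.
  move=> /andP[s0 s1]; rewrite mulrA normrM (ger0_norm s0).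
  by apply: le_lt_trans lamt_lt1; rewrite ler_piMr.
have seg_gt0 (s : R) : 0 <= s <= 1 -> 0 < 1 + lam * (t * s).
  by move=> /seg_lt1; rewrite ltr_norml => /andP[+ _]; lra.
(* Rescaling to [0, 1] treats both signs of t at once. *)
pose h (s : R) := degen_exp lam y (t * s) * (1 + lam * (t * s)) `^ (- (y / lam)).
have dh (s : R) : 0 <= s <= 1 -> is_derive s (1 : R) h 0.
  move=> s01; have b_gt0 := seg_gt0 _ s01.
  have d1 := is_derive_degen_exp y lam0 (seg_lt1 _ s01).
  have d2 := is_derive1_powR (- (y / lam)) b_gt0.
  have dt : is_derive s (1 : R) (fun s : R => t * s) t.
    by apply: is_derive_eq; rewrite /GRing.scale/=; ring.
  have db : is_derive s (1 : R) (fun s : R => 1 + lam * (t * s)) (lam * t).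
    by apply: is_derive_eq; rewrite /GRing.scale/=; ring.
  have e1 := @is_derive1_comp _ (degen_exp lam y) (fun s : R => t * s) _ _ _ d1 dt.
  have e2 := @is_derive1_comp _ (fun u : R => u `^ (- (y / lam)))
               (fun s : R => 1 + lam * (t * s)) _ _ _ d2 db.
  have e3 := is_deriveM e1 e2.
  apply: (is_derive_eq (f := h) e3).
  rewrite /GRing.scale/=.
  rewrite -(degen_exp_pascal y (seg_lt1 _ s01)).
  rewrite powRD ?(gt_eqF b_gt0) ?implybT// powR_inv1 ?ltW//.
  by field; rewrite lam0 lt0r_neq0.
have dh_in (s : R) : s \in `]0, 1[ -> is_derive s (1 : R) h 0.
  by rewrite in_itv/= => /andP[s0 s1]; apply: dh; rewrite !ltW.
have [|c _] := MVT_segment ler01 dh_in.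
  apply: derivable_within_continuous => s; rewrite in_itv/= => s01.
  have dhs := dh s s01; exact: ex_derive.
rewrite mul0r /h !mulr1 !mulr0 addr0 powR1 mulr1 => /eqP; rewrite subr_eq0.
have -> : degen_exp lam y 0 = 1.
  rewrite degen_expE; apply: cvg_lim => //; rewrite -cvg_shiftS/=.
  rewrite (_ : (fun n => _) = (fun=> 1)); first exact: cvg_cst.
  apply/funext => n; rewrite /pseries /series/= big_nat_recl//= big1 ?addr0.
    by rewrite /degen_coef /degen_falling big_ord0 expr0 mulr1 divr1.
  by move=> k _; rewrite expr0n mulr0.
have b_gt0 : 0 < 1 + lam * t by have := seg_gt0 1; rewrite mulr1 lexx ler01 => ->.
have pow_neq0 : (1 + lam * t) `^ (y / lam) != 0 by rewrite lt0r_neq0 ?powR_gt0.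
by rewrite powRN => /eqP/(canRL (mulfVK pow_neq0)); rewrite mul1r.
Qed.

End DegenerateExponential.

(** * Uniqueness of coefficients *)
Section UniqueCoefficients.
Variable R : realType.
Implicit Types (a : R^nat) (F : R -> R) (delta : R).

Lemma pseriesS a t n :
  pseries a t n.+1 = a 0 + t * pseries (fun k => a k.+1) t n.
Proof.
rewrite /pseries /series/= big_nat_recl//= expr0 mulr1 mulr_sumr; congr (_ + _).
by apply: eq_bigr => k _; rewrite exprS mulrCA.
Qed.

(** The value t = 0 is excluded from the hypothesis, which makes the statement
    stable under division of the series by t. The tail is O(t) because the
    series converges absolutely inside the disc, so letting t tend to 0 leaves
    the constant term. *)
Lemma pseries0_coef0 a delta : 0 < delta ->
  (forall t, 0 < `|t| < delta -> pseries a t @ \oo --> 0) -> a 0 = 0.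
Proof.
move=> delta_gt0 a_cvg0.
pose t0 := delta / 2; pose t1 := delta / 4.
have t0_gt0 : 0 < t0 by rewrite /t0; lra.
have t1_gt0 : 0 < t1 by rewrite /t1; lra.
have cvg_abs : cvgn (pseries (fun k => `|a k|) t1).
  apply: (@is_cvg_pseries_inside_norm _ a t0).
    apply/cvgP/a_cvg0; rewrite gtr0_norm//; apply/andP; split=> //.
    by rewrite /t0; lra.
  by rewrite !gtr0_norm// /t0 /t1; lra.
have [K K_bound] : exists K, forall n, pseries (fun k => `|a k|) t1 n <= K.
  exists (limn (pseries (fun k => `|a k|) t1)) => n.
  apply: nondecreasing_cvgn_le => //; apply: nondecreasing_series => k _ _.
  by rewrite mulr_ge0// exprn_ge0// ltW.
have tail_bound t n : 0 < t <= t1 -> `|pseries a t n.+1 - a 0| <= t * (K / t1).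
  move=> /andP[t_gt0 t_le]; rewrite pseriesS addrAC subrr add0r normrM gtr0_norm//.
  rewrite ler_pM2l// ler_pdivlMr//.
  apply: le_trans (K_bound n.+1); rewrite pseriesS mulrC -[leLHS]add0r.
  apply: lerD => //; rewrite ler_pM2l// /pseries /series/=.
  apply: (le_trans (ler_norm_sum _ _ _)); apply: ler_sum => k _.
  by rewrite normrM ler_wpM2l// normrX gtr0_norm// lerXn2r// nnegrE ltW.
have a0_bound t : 0 < t <= t1 -> `|a 0| <= t * (K / t1).
  move=> t_le; have /andP[t_gt0 t_le1] := t_le.
  have t_range : 0 < `|t| < delta.
    by rewrite gtr0_norm// t_gt0/= (le_lt_trans t_le1)// /t1; lra.
  have : (fun n => `|pseries a t n.+1 - a 0|) @ \oo --> `|0 - a 0|.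
    by apply: cvg_norm; apply: cvgB; [rewrite cvg_shiftS; exact: a_cvg0|exact: cvg_cst].
  rewrite sub0r normrN => lim_a0; rewrite -(cvg_lim _ lim_a0)//.
  apply: limr_le; first exact/cvgP/lim_a0.
  by apply: nearW => n; exact: tail_bound.
apply/eqP/negPn/negP => a0_neq0.
have a0_gt0 : 0 < `|a 0| by rewrite normr_gt0.
have K_gt0 : 0 < K.
  apply: lt_le_trans a0_gt0 _; have := a0_bound t1.
  by rewrite t1_gt0 lexx mulrC divfK ?lt0r_neq0// => /(_ isT).
(* Small enough for the bound of [a0_bound] to be at most half of |a 0|. *)
pose t := Num.min t1 (`|a 0| * t1 / K / 2).
have t_le : t <= `|a 0| * t1 / K / 2 by rewrite /t ge_min lexx orbT.
have := a0_bound t; rewrite /t lt_min t1_gt0/= ge_min lexx/= andbT.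
rewrite !(divr_gt0, mulr_gt0)// => /(_ isT).
rewrite -/t leNgt => /negP; apply.
apply: (@le_lt_trans _ _ (`|a 0| / 2)); last by lra.
rewrite mulrA ler_pdivrMr// -ler_pdivlMr//.
by apply: (le_trans t_le); rewrite le_eqVlt; apply/orP; left; apply/eqP; field;
  exact: lt0r_neq0.
Qed.

(** Once the constant term vanishes, dividing by t shifts the coefficients. *)
Lemma pseries0_coef a delta : 0 < delta ->
  (forall t, 0 < `|t| < delta -> pseries a t @ \oo --> 0) -> forall k, a k = 0.
Proof.
move=> delta_gt0 a_cvg0 k; elim: k a a_cvg0 => [|k IHk] a a_cvg0.
  exact: pseries0_coef0 a_cvg0.
have a0 := pseries0_coef0 delta_gt0 a_cvg0.
apply: (IHk (fun k => a k.+1)) => t t_range.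
have t_neq0 : t != 0 by case/andP: t_range; rewrite normr_gt0.
rewrite (_ : pseries _ t = (fun n => t^-1 * pseries a t n.+1)); last first.
  by apply/funext => n; rewrite pseriesS a0 add0r mulKf.
rewrite -(mulr0 t^-1); apply: cvgMl_tmp; rewrite cvg_shiftS; exact: a_cvg0.
Qed.

Lemma sum_from_low m n a (c : R^nat) : (forall k, (k < m)%N -> a k = 0) ->
  \sum_(m <= k < n) a k * c k = \sum_(0 <= k < n) a k * c k.
Proof.
move=> a_low; case: (leqP m n) => [mn|/ltnW nm].
  rewrite [RHS](big_cat_nat _ mn)//= [X in _ = X + _]big_nat.
  rewrite [X in _ = X + _]big1 ?add0r// => k /andP[_ km].
  by rewrite a_low ?mul0r.
rewrite big_geq// big_nat big1// => k /andP[_ kn].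
by rewrite a_low ?mul0r// (leq_trans kn).
Qed.

(** Vanishing of the coefficients below rank m lets a series starting at m be
    read as a full power series. *)
Lemma is_egf_pseries m F a : is_egf m F a ->
  \forall t \near 0, pseries (fun k => a k / k`!%:R) t @ \oo --> F t.
Proof.
move=> [a_low]; apply: filterS => t.
rewrite (_ : (fun n => _) = pseries (fun k => a k / k`!%:R) t)//.
apply/funext => n; rewrite /pseries /series/=.
under [RHS]eq_bigr do rewrite mulrAC -mulrA.
exact: sum_from_low.
Qed.

Lemma egf_coefE m F a : is_egf m F a -> egf_coef m F = a.
Proof.
move=> egf_a; apply: xget_unique => // b egf_b.
apply/funext => k; apply/eqP; rewrite -subr_eq0; apply/eqP.
have : \forall t \near (0 : R),
    pseries (fun k => (b k - a k) / k`!%:R) t @ \oo --> (0 : R).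
  move: (is_egf_pseries egf_b) (is_egf_pseries egf_a).
  apply: filterS2 => t cvg_b cvg_a; rewrite -(subrr (F t)).
  rewrite (_ : pseries _ t = (fun n => pseries (fun k => b k / k`!%:R) t n -
                                       pseries (fun k => a k / k`!%:R) t n)).
    exact: cvgB.
  apply/funext => n; rewrite /pseries /series/= -sumrB.
  by apply: eq_bigr => i _; rewrite !mulrBl.
move=> /nbhs_ballP[delta /= delta_gt0 ball_cvg].
have /eqP : (b k - a k) / k`!%:R = 0.
  apply: (@pseries0_coef (fun k => (b k - a k) / k`!%:R) delta) => // t /andP[_ t_lt].
  by apply: ball_cvg; rewrite /ball/= sub0r normrN.
by rewrite mulf_eq0 invr_eq0 pnatr_eq0 (gtn_eqF (fact_gt0 k)) orbF => /eqP.
Qed.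

End UniqueCoefficients.

(** * Degenerate Stirling numbers of the first kind *)
Section DegenerateStirling.
Variable R : realType.
Implicit Types lam t : R.

(** The j-th Taylor coefficient (times j!) of (1 - (1 - t)^lam)^l, expanded by
    the binomial theorem: (1 - t)^(i lam) is e_(-1)^(- i lam)(t). *)
Definition alt_sum lam (l j : nat) : R :=
  \sum_(i < l.+1) (-1) ^+ i * 'C(l, i)%:R * degen_falling (-1) (- (i%:R * lam)) j.

Definition stirling1 lam (l j : nat) : R :=
  (l`!%:R * lam ^+ l)^-1 * alt_sum lam l j.

Lemma alt_sum0 lam l : alt_sum lam l 0 = (l == 0%N)%:R.
Proof.
transitivity ((1 - 1 : R) ^+ l); last by rewrite subrr expr0n.
rewrite exprBn; apply: eq_bigr => i _.
by rewrite /degen_falling big_ord0 !expr1n !mulr1 mulr_natr.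
Qed.

(** The last factor of the falling factorial is j - i lam, and the factor i is
    absorbed by the binomial coefficient:
    i C(l+1, i) = (l+1) (C(l+1, i) - C(l, i)). *)
Lemma alt_sumS lam l j :
  alt_sum lam l.+1 j.+1 =
  (j%:R - l.+1%:R * lam) * alt_sum lam l.+1 j + l.+1%:R * lam * alt_sum lam l j.
Proof.
(* The added term i = l + 1 vanishes; both sums then have the same range. *)
have -> : alt_sum lam l j = \sum_(i < l.+2) (-1) ^+ i * 'C(l, i)%:R *
    degen_falling (-1) (- (i%:R * lam)) j.
  by rewrite [RHS]big_ord_recr/= bin_small// mulr0 mul0r addr0.
rewrite /alt_sum !mulr_sumr -big_split/=; apply: eq_bigr => i _.
rewrite degen_fallingS.
have absorb : i%:R * 'C(l.+1, i)%:R = l.+1%:R * ('C(l.+1, i)%:R - 'C(l, i)%:R) :> R.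
  case: (nat_of_ord i) => [|k]; first by rewrite !bin0 subrr mulr0 mulr0n mul0r.
  have -> : 'C(l.+1, k.+1)%:R - 'C(l, k.+1)%:R = 'C(l, k)%:R :> R.
    by rewrite binS natrD addrAC subrr add0r.
  by rewrite -!natrM mul_bin_diag.
transitivity ((-1) ^+ i * degen_falling (-1) (- (i%:R * lam)) j *
   (j%:R * 'C(l.+1, i)%:R - lam * (i%:R * 'C(l.+1, i)%:R))); first by ring.
by rewrite absorb; ring.
Qed.

Lemma stirling10S lam j : stirling1 lam 0 j.+1 = j%:R * stirling1 lam 0 j.
Proof.
rewrite /stirling1 /alt_sum !big_ord_recl !big_ord0/= degen_fallingS.
by rewrite mul0r; ring.
Qed.

Lemma stirling1S lam l j : lam != 0 -> stirling1 lam l.+1 j.+1 =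
  (j%:R - l.+1%:R * lam) * stirling1 lam l.+1 j + stirling1 lam l j.
Proof.
move=> lam0; rewrite /stirling1 alt_sumS factS natrM exprS.
have -> : l.+1%:R * l`!%:R * (lam * lam ^+ l) =
    l`!%:R * lam ^+ l * (l.+1%:R * lam) by ring.
rewrite mulrDr; congr (_ + _); first by rewrite mulrCA.
by rewrite invfM -[LHS]mulrA mulKf// mulf_neq0// pnatr_eq0.
Qed.

Lemma stirling1_0 lam l : stirling1 lam l 0 = (l == 0%N)%:R.
Proof.
rewrite /stirling1 alt_sum0; case: l => [|l]; last by rewrite mulr0.
by rewrite expr0 !mulr1 invr1.
Qed.

Lemma stirling1_small lam l j : lam != 0 -> (j < l)%N -> stirling1 lam l j = 0.
Proof.
move=> lam0; elim: j l => [|j IHj] [|l]// jl; first by rewrite stirling1_0.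
by rewrite stirling1S// !IHj// ?mulr0 ?addr0// ltnW.
Qed.

(** By the recurrence, passing from j to j + 1 multiplies each
    [j, l] <1>_{l,lam} by (1 + l lam) + (j - l lam) = j + 1: one summand comes
    from raising l, the other from keeping it. *)
Lemma sum_stirling1_rising lam j : lam != 0 ->
  \sum_(0 <= l < j.+1) stirling1 lam l j * degen_rising lam 1 l = j`!%:R.
Proof.
move=> lam0; elim: j => [|j IHj].
  by rewrite big_nat1 stirling1_0 /degen_rising big_ord0 mulr1.
have risingS l : degen_rising lam 1 l.+1 = degen_rising lam 1 l * (1 + l%:R * lam).
  by rewrite /degen_rising big_ord_recr.
pose f l := (j%:R - l%:R * lam) * (stirling1 lam l j * degen_rising lam 1 l).
rewrite big_nat_recl//.
under eq_bigr do rewrite stirling1S// mulrDl -mulrA -/(f _.+1).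
rewrite big_split/= addrA.
have -> : stirling1 lam 0 j.+1 * degen_rising lam 1 0 = f 0%N.
  by rewrite /f stirling10S mul0r subr0 -[LHS]mulrA.
rewrite -(big_nat_recl _ _ f)// big_nat_recr//=.
rewrite [f j.+1]/f stirling1_small// mul0r mulr0 addr0 -big_split/=.
rewrite factS natrM -IHj mulr_sumr; apply: eq_bigr => l _.
by rewrite /f risingS -nat1r; ring.
Qed.

(** The smallness hypothesis places ((1 - t)^lam - 1) / lam in the disc on which
    [degen_log] looks for its value; on that disc e_lam is the injective function
    s |-> (1 + lam s)^(1 / lam). *)
Lemma degen_logE lam t : lam != 0 -> `|t| < 1 -> `|(1 - t) `^ lam - 1| < 1 ->
  degen_log lam (1 - t) = ((1 - t) `^ lam - 1) / lam.
Proof.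
move=> lam0 t_lt1 small.
have t_gt0 : 0 < 1 - t by move: t_lt1; rewrite ltr_norml => /andP[_]; lra.
have lamK : lam * (((1 - t) `^ lam - 1) / lam) = (1 - t) `^ lam - 1.
  by rewrite mulrC divfK.
apply: xget_unique => [|s [lams_lt1]].
  split; first by rewrite lamK.
  rewrite degen_exp_powR// lamK// addrC subrK -powRrM mul1r divff// powRr1//.
  exact: ltW.
rewrite degen_exp_powR// => <-; rewrite -powRrM mul1r mulVf// powRr1.
  by rewrite addrAC subrr add0r mulrC mulKf.
by move: lams_lt1; rewrite ltr_norml => /andP[]; lra.
Qed.

Lemma is_egf_stirling1 lam l : lam != 0 ->
  is_egf l (fun t => (-1) ^+ l / l`!%:R * degen_log lam (1 - t) ^+ l)
    (stirling1 lam l).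
Proof.
move=> lam0; split; first by move=> k; exact: stirling1_small.
(* Continuity of (1 - t)^lam at t = 0, obtained from differentiability. *)
have powR_near : \forall t \near (0 : R), `|(1 - t) `^ lam - 1| < 1.
  have : (1 - t) `^ lam @[t --> (0 : R)] --> (1 - 0 : R) `^ lam.
    have d1 : is_derive (1 - 0 : R) (1 : R) (fun u : R => u `^ lam)
        (lam * (1 - 0) `^ (lam - 1)).
      by apply: is_derive1_powR; rewrite subr0.
    have d2 : is_derive (0 : R) (1 : R) (fun t : R => 1 - t) (-1).
      by apply: is_derive_eq; rewrite add0r mul1r.
    have d := @is_derive1_comp _ (fun u : R => u `^ lam) (fun t : R => 1 - t) _ _ _ d1 d2.
    have /derivable1_diffP/differentiable_continuous :=
      ex_derive (is_derive := d).
    exact.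
  rewrite subr0 powR1 => /cvgrPdist_lt/(_ 1 ltr01).
  by apply: filterS => t; rewrite distrC.
have lt1_near : \forall t \near (0 : R), `|t| < 1 by exact: nbhs0_lt.
move: lt1_near powR_near; apply: filterS2 => t t_lt1 powR_small.
have t_gt0 : 0 < 1 - t by move: t_lt1; rewrite ltr_norml => /andP[_]; lra.
rewrite degen_logE//.
(* Partial sums: the l-th series is a combination of l + 1 binomial series. *)
rewrite (_ : (fun n => _) = (fun n => (l`!%:R * lam ^+ l)^-1 *
   \sum_(i < l.+1) (-1) ^+ i * 'C(l, i)%:R *
     pseries (degen_coef (-1) (- (i%:R * lam))) t n)); last first.
  apply/funext => n.
  transitivity (\sum_(0 <= k < n) stirling1 lam l k * (t ^+ k / k`!%:R)).
    by apply: sum_from_low => k; exact: stirling1_small.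
  rewrite /stirling1 /alt_sum.
  under eq_bigr do rewrite -mulrA mulr_suml.
  rewrite -mulr_sumr exchange_big/=; congr (_ * _); apply: eq_bigr => i _.
  rewrite /pseries /series/= mulr_sumr; apply: eq_bigr => k _.
  by rewrite /degen_coef -!mulrA (mulrC (t ^+ k)).
rewrite (_ : (-1) ^+ l / l`!%:R * _ = (l`!%:R * lam ^+ l)^-1 *
  \sum_(i < l.+1) (-1) ^+ i * 'C(l, i)%:R * (1 - t) `^ lam ^+ i); last first.
  rewrite [X in _ = _ * X](_ : _ = (1 - (1 - t) `^ lam) ^+ l); last first.
    rewrite exprBn; apply: eq_bigr => i _.
    by rewrite expr1n mulr1 -[RHS]mulr_natr [RHS]mulrAC.
  rewrite -(opprB ((1 - t) `^ lam)) (exprNn ((1 - t) `^ lam - 1)) invfM.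
  by rewrite expr_div_n; ring.
apply: cvgMl_tmp; apply: cvg_big => [|i _]; first exact: add_continuous.
apply: cvgMl_tmp.
have small : `|-1 * t| < 1 by rewrite mulN1r normrN.
have -> : (1 - t) `^ lam ^+ i = degen_exp (-1) (- (i%:R * lam)) t.
  rewrite degen_exp_powR ?oppr_eq0 ?oner_eq0// invrN1 mulrN1 opprK mulN1r.
  by rewrite mulrC powRrM powR_mulrn// powR_ge0.
by rewrite degen_expE; exact: is_cvg_degen_coef.
Qed.

Lemma degen_stirling1E lam l j : lam != 0 ->
  degen_stirling1 lam j l = stirling1 lam l j.
Proof. by move=> lam0; rewrite /degen_stirling1 (egf_coefE (is_egf_stirling1 l lam0)). Qed.

End DegenerateStirling.

(** * Termwise expectation *)
Section ExpectationSeries.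
Context {R : realType} {d : measure_display} {T : measurableType d}.
Variables (P : probability T R) (Y : {RV P >-> R}).
Implicit Types lam y t r : R.

Lemma norm_degen_falling_le lam y k :
  `|degen_falling lam y k| <= degen_falling (- `|lam|) `|y| k.
Proof.
rewrite /degen_falling normr_prod; apply: ler_prod => i _.
rewrite normr_ge0/= mulrN opprK; apply: (le_trans (ler_normB _ _)).
by rewrite normrM ger0_norm.
Qed.

(** Replacing lam by -|lam|, y by |y| and t by t0 makes every term of the series
    nonnegative and at least as large, so a single value of the degenerate
    exponential bounds all partial sums, uniformly in t. *)
Lemma sum_norm_degen_le lam y t t0 n : 0 < t0 -> `|lam| * t0 < 1 -> `|t| <= t0 ->
  \sum_(0 <= k < n) `|degen_falling lam y k * (t ^+ k / k`!%:R)|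
    <= degen_exp (- `|lam|) `|y| t0.
Proof.
move=> t0_gt0 lamt0 t_le.
have small : `|- `|lam| * t0| < 1.
  by rewrite mulNr normrN normrM normr_id (gtr0_norm t0_gt0).
have coef_ge0 k : 0 <= degen_falling (- `|lam|) `|y| k.
  exact: le_trans (norm_degen_falling_le lam y k).
rewrite degen_expE; apply: (@le_trans _ _ (pseries (degen_coef (- `|lam|) `|y|) t0 n)).
  apply: ler_sum => k _ /=; rewrite /degen_coef [leRHS]mulrAC -[leRHS]mulrA normrM.
  apply: ler_pM => //; first exact: norm_degen_falling_le.
  rewrite normrM normfV (ger0_norm (ler0n _ _)) ler_pM2r ?invr_gt0 ?ltr0n ?fact_gt0//.
  by rewrite normrX lerXn2r// nnegrE ltW.
apply: nondecreasing_cvgn_le; last exact: is_cvg_degen_coef.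
apply: nondecreasing_series => k _ _.
by rewrite mulr_ge0// ?divr_ge0// exprn_ge0// ltW.
Qed.

(** By the binomial series the bound of [sum_norm_degen_le] is
    (1 - |lam| t0)^(- |y| / |lam|); t0 is chosen so that this equals
    exp(|y| r / 2). For y = Y this lies below exp(Y r / 2) + exp(- Y r / 2),
    whose expectation is a sum of two values of the mgf. *)
Lemma degen_exp_majorant lam r : lam != 0 -> 0 < r ->
  exists t0, [/\ 0 < t0, `|lam| * t0 < 1 &
    forall y, degen_exp (- `|lam|) `|y| t0 <= expR (y * (r / 2)) + expR (y * (- (r / 2)))].
Proof.
move=> lam0 r_gt0; have lam_gt0 : 0 < `|lam| by rewrite normr_gt0.
pose e := expR (- (`|lam| * (r / 2))).
have e_lt1 : e < 1 by rewrite expR_lt1 oppr_lt0 mulr_gt0// divr_gt0.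
have e_gt0 : 0 < e by exact: expR_gt0.
pose t0 := (1 - e) / `|lam|.
have t0_gt0 : 0 < t0 by rewrite divr_gt0// subr_gt0.
have lamt0 : `|lam| * t0 = 1 - e by rewrite mulrC divfK// lt0r_neq0.
exists t0; split=> // [|y]; first by rewrite lamt0; lra.
rewrite degen_exp_powR ?oppr_eq0 ?lt0r_neq0//; last first.
  by rewrite mulNr normrN lamt0 gtr0_norm; lra.
rewrite mulNr lamt0 opprB addrC subrK /powR (gt_eqF e_gt0) expRK.
rewrite (_ : `|y| / - `|lam| * - (`|lam| * (r / 2)) = `|y| * (r / 2)); last first.
  by field; rewrite lt0r_neq0.
have [y_ge0|y_lt0] := ger0P y; first by rewrite lerDl expR_ge0.
by rewrite mulNr -mulrN lerDr expR_ge0.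
Qed.

Lemma integrable_expR r t : (forall s : R, `|s| < r -> ('M_P Y s < +oo)%E) ->
  `|t| < r -> P.-integrable setT (EFin \o (fun w => expR (Y w * t))).
Proof.
move=> mgf t_lt; apply/integrableP; split.
  apply/measurable_EFinP; apply: measurableT_comp => //.
  by apply: measurable_funM => //; exact: measurable_funPT.
apply: le_lt_trans (mgf t t_lt); rewrite /mmt_gen_fun unlock.
rewrite le_eqVlt; apply/orP; left; apply/eqP; apply: eq_integral => w _ /=.
by rewrite ger0_norm// expR_ge0.
Qed.

Lemma measurable_degen_falling lam k :
  measurable_fun setT (fun w => degen_falling lam (- Y w) k).
Proof.
apply: measurable_prod => i _; apply: measurable_funB => //.
by apply: measurableT_comp => //; exact: measurable_funPT.
Qed.

Section MgfFinite.
Variables (lam r : R).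
Hypotheses (lam_neq0 : lam != 0) (r_gt0 : 0 < r).
Hypothesis mgf_lty : forall t : R, `|t| < r -> ('M_P Y t < +oo)%E.

(* 2 cosh(r Y / 2), the integrable majorant. *)
Let g w : R := expR (Y w * (r / 2)) + expR (Y w * (- (r / 2))).

Let g_ge0 w : 0 <= g w. Proof. by rewrite addr_ge0// expR_ge0. Qed.

Let integrable_g : P.-integrable setT (EFin \o g).
Proof.
have r2_lt : `|r / 2| < r by rewrite gtr0_norm ?divr_gt0// ltr_pdivrMr// ltr_pMr// ltr1n.
rewrite (_ : EFin \o g = (EFin \o (fun w => expR (Y w * (r / 2)))) \+
   (EFin \o (fun w => expR (Y w * (- (r / 2))))))%E; last by [].
by apply: integrableD => //; apply: (integrable_expR mgf_lty); rewrite ?normrN.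
Qed.

(** A single term of the dominated series at t0 controls the k-th factorial
    moment. *)
Lemma integrable_degen_falling k :
  P.-integrable setT (EFin \o (fun w => degen_falling lam (- Y w) k)).
Proof.
have [t0 [t0_gt0 lamt0 majorant]] := degen_exp_majorant lam_neq0 r_gt0.
pose c := k`!%:R / t0 ^+ k.
have tk_gt0 : 0 < t0 ^+ k by rewrite exprn_gt0.
have fk_gt0 : 0 < k`!%:R :> R by rewrite ltr0n fact_gt0.
have := @integrableZl _ T R P setT measurableT c _ integrable_g.
apply: le_integrable => //.
  by apply/measurable_EFinP; exact: measurable_degen_falling.
move=> w _ /=; rewrite lee_fin [leRHS]ger0_norm; last first.
  by rewrite mulr_ge0// divr_ge0// ltW.
rewrite /c mulrAC ler_pdivlMr// mulrC -ler_pdivrMl// mulrA mulrC.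
apply: le_trans (majorant (Y w)).
have t0_le : `|t0| <= t0 by rewrite gtr0_norm.
have := sum_norm_degen_le (- Y w) k.+1 t0_gt0 lamt0 t0_le.
rewrite normrN; apply: le_trans; rewrite big_nat_recr//= -[leLHS]add0r.
apply: lerD; first by apply: sumr_ge0 => i _.
by rewrite normrM [`|_ / _|]ger0_norm ?divr_ge0 ?(ltW tk_gt0)// [X in _ * X]mulrC.
Qed.

(** Dominated convergence applied to the partial sums. *)
Lemma is_egf_expectation_degen_exp :
  is_egf 0 (fun t => fine ('E_P[fun w => degen_exp lam (- Y w) t])%E)
    (fun k => fine ('E_P[fun w => degen_falling lam (- Y w) k])%E).
Proof.
split=> //.
have [t0 [t0_gt0 lamt0 majorant]] := degen_exp_majorant lam_neq0 r_gt0.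
have := @nbhs0_lt R R t0 t0_gt0; apply: filterS => t t_lt.
have small : `|lam * t| < 1.
  by rewrite normrM; apply: le_lt_trans lamt0; rewrite ler_wpM2l// ltW.
pose f n w : R := \sum_(0 <= k < n) degen_falling lam (- Y w) k * (t ^+ k / k`!%:R).
have f_cvg w : f ^~ w @ \oo --> degen_exp lam (- Y w) t.
  rewrite degen_expE (_ : f ^~ w = pseries (degen_coef lam (- Y w)) t).
    exact: is_cvg_degen_coef.
  apply/funext => n; apply: eq_bigr => k _.
  by rewrite /= /degen_coef [RHS]mulrAC -mulrA.
have f_le n w : `|f n w| <= g w.
  apply: (le_trans (ler_norm_sum _ _ _)).
  by apply: le_trans (majorant (Y w)); rewrite -(normrN (Y w)) sum_norm_degen_le// ltW.
have measurable_f n : measurable_fun setT (EFin \o f n).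
  apply/measurable_EFinP; apply: measurable_sum => k.
  by apply: measurable_funM => //; exact: measurable_degen_falling.
have measurable_lim :
    measurable_fun setT (EFin \o (fun w => degen_exp lam (- Y w) t)).
  apply/measurable_EFinP; apply: (measurable_fun_cvg (h := f)) => [n|w _].
    by apply/measurable_EFinP.
  exact: f_cvg.
have [||integrable_lim _ cvg_int] := @dominated_convergence _ T R P setT measurableT
  (fun n => EFin \o f n) _ (EFin \o g) measurable_f measurable_lim _ integrable_g.
- by apply: aeW => w _; apply/fine_cvgP; split; [exact: nearW|exact: f_cvg].
- by apply: aeW => w n _; rewrite /= lee_fin.
have expE (X : T -> R) : ('E_P[X] = \int[P]_w (X w)%:E)%E by rewrite unlock.
rewrite expE.
have lim_fin : (\int[P]_w (degen_exp lam (- Y w) t)%:E)%E \is a fin_num.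
  exact: (integrable_fin_num measurableT integrable_lim).
have := cvg_int; rewrite -[X in _ --> X](fineK lim_fin) => /fine_cvg.
set u := (X in X @ \oo --> _ -> _); set v := (X in _ -> X @ \oo --> _).
suff -> : u = v by [].
apply/funext => n; rewrite /u /v /=.
rewrite /f.
under eq_integral do rewrite -sumEFin.
rewrite (integral_sum measurableT); last first.
  move=> k; under eq_fun do rewrite mulrC EFinM.
  exact: (integrableZl measurableT _ (integrable_degen_falling k)).
transitivity (fine (\sum_(0 <= k < n)
    (fine ('E_P[fun w => degen_falling lam (- Y w) k])%E * (t ^+ k / k`!%:R))%:E)%E); last first.
  by rewrite sumEFin.
congr fine; apply: eq_bigr => k _.
under eq_integral do rewrite mulrC EFinM.
rewrite (integralZl measurableT (integrable_degen_falling k)) expE EFinM fineK 1?muleC//.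
exact: (integrable_fin_num measurableT (integrable_degen_falling k)).
Qed.

Lemma expectation_degen_falling k :
  fine ('E_P[fun w => degen_falling lam (- Y w) k])%E =
  (-1) ^+ k * fine ('E_P[fun w => degen_rising lam (Y w) k])%E.
Proof.
have fallingE w : degen_falling lam (- Y w) k = (-1) ^+ k * degen_rising lam (Y w) k.
  rewrite /degen_falling; under eq_bigr do rewrite -opprD -mulN1r.
  by rewrite big_split/= prodr_const card_ord.
have risingE w : degen_rising lam (Y w) k = (-1) ^+ k * degen_falling lam (- Y w) k.
  by rewrite fallingE mulrA -expr2 sqrr_sign mul1r.
have -> : (fun w => degen_rising lam (Y w) k) =
    (fun w => (-1) ^+ k * degen_falling lam (- Y w) k) by exact/funext.
rewrite unlock; under [in RHS]eq_integral do rewrite EFinM.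
have int_k := integrable_degen_falling k.
rewrite (integralZl measurableT int_k) fineM//=.
  by rewrite mulrA -expr2 sqrr_sign mul1r.
exact: (integrable_fin_num measurableT int_k).
Qed.

End MgfFinite.
End ExpectationSeries.

(** * Multiplication by a geometric series *)

(** The error u_n - l / (1 - q) satisfies the same recurrence with v_n - l,
    which tends to 0, as source; being contracted by q at each step, it tends
    to 0. *)
Lemma cvg_geometric_convolution (R : realType) (u v : R^nat) (q l : R) :
  `|q| < 1 -> (forall n, u n.+1 = v n.+1 + q * u n) -> v @ \oo --> l ->
  u @ \oo --> (1 - q)^-1 * l.
Proof.
move=> q_lt1 uS v_l; set L := (1 - q)^-1 * l.
have q_neq1 : 1 - q != 0.
  by rewrite subr_eq0 eq_sym; apply: contraTneq q_lt1 => ->; rewrite normr1 ltxx.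
have errS n : u n.+1 - L = (v n.+1 - l) + q * (u n - L).
  by rewrite uS /L; field.
apply/cvgrPdist_le => e e_gt0.
have gap_gt0 : 0 < 1 - `|q| by rewrite subr_gt0.
have e2_gt0 : 0 < e / 2 by rewrite divr_gt0.
have [N _ v_close] : \forall n \near \oo, `|l - v n| <= e / 2 * (1 - `|q|).
  by move/cvgrPdist_le : v_l; apply; rewrite mulr_gt0.
have err_bound m : `|u (N + m)%N - L| <= `|q| ^+ m * `|u N - L| + e / 2.
  elim: m => [|m IHm]; first by rewrite addn0 expr0 mul1r lerDl ltW.
  rewrite addnS errS; apply: (le_trans (ler_normD _ _)); rewrite normrM distrC.
  have v_m : `|l - v (N + m).+1| <= e / 2 * (1 - `|q|).
    by apply: v_close; rewrite /= -addnS leq_addr.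
  have := ler_wpM2l (normr_ge0 q) IHm.
  by rewrite exprS -!mulrA; lra.
have : (fun m => `|q| ^+ m * `|u N - L|) @ \oo --> 0 * `|u N - L|.
  by apply: cvgMr_tmp; apply: cvg_expr; rewrite normr_id.
rewrite mul0r => /cvgrPdist_le/(_ _ e2_gt0)[M _ tail_small].
exists (N + M)%N => // n /= NM_n.
have -> : n = (N + (n - N))%N by rewrite subnKC// (leq_trans _ NM_n)// leq_addr.
rewrite distrC; apply: (le_trans (err_bound _)).
have := tail_small (n - N)%N; rewrite /= leq_subRL; last first.
  by rewrite (leq_trans _ NM_n)// leq_addr.
move=> /(_ NM_n); rewrite sub0r normrN ger0_norm ?mulr_ge0// ?exprn_ge0//.
by lra.
Qed.

(** Writing g_n for the n-th Taylor coefficient of the product and b_n / n! for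
    that of G, one has g_(n+1) = b_(n+1) / (n+1)! + x g_n. The partial sums
    therefore follow the recurrence of [cvg_geometric_convolution] with q = x t,
    and convergence of the series of G, absolute or not, suffices. *)
Lemma is_egf_geometric_mul (R : realType) (G : R -> R) (b : R^nat) (x : R) :
  is_egf 0 G b ->
  is_egf 0 (fun t => (1 - x * t)^-1 * G t)
    (fun n => \sum_(0 <= j < n.+1) 'C(n, j)%:R * j`!%:R * x ^+ j * b (n - j)%N).
Proof.
move=> [_ egf_b]; split=> //.
pose a n : R := \sum_(0 <= j < n.+1) 'C(n, j)%:R * j`!%:R * x ^+ j * b (n - j)%N.
rewrite -/a.
have aE n : a n / n`!%:R = \sum_(0 <= j < n.+1) x ^+ j * (b (n - j)%N / (n - j)`!%:R).
  rewrite /a mulr_suml !big_mkord; apply: eq_bigr => -[j jn] _ /=.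
  have -> : n`!%:R = 'C(n, j)%:R * j`!%:R * (n - j)`!%:R :> R.
    by rewrite -!natrM -mulnA bin_fact.
  have bin_neq0 : 'C(n, j)%:R != 0 :> R by rewrite pnatr_eq0 -lt0n bin_gt0.
  have fact_neq0 k : k`!%:R != 0 :> R by rewrite pnatr_eq0 -lt0n fact_gt0.
  by field; rewrite !fact_neq0 bin_neq0.
have aS n : a n.+1 / n.+1`!%:R = b n.+1 / n.+1`!%:R + x * (a n / n`!%:R).
  rewrite !aE big_nat_recl// expr0 mul1r subn0 mulr_sumr; congr (_ + _).
  by apply: eq_bigr => j _; rewrite subSS exprS -mulrA.
have xt_lt1 : \forall t \near (0 : R), `|x * t| < 1.
  have x1_gt0 : 0 < (`|x| + 1)^-1 by rewrite invr_gt0 ltr_wpDl.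
  have := @nbhs0_lt R R _ x1_gt0; apply: filterS => t t_lt.
  rewrite normrM; have [->|x_neq0] := eqVneq x 0; first by rewrite normr0 mul0r.
  have x_gt0 : 0 < `|x| by rewrite normr_gt0.
  apply: (@lt_trans _ _ (`|x| * (`|x| + 1)^-1)); first by rewrite ltr_pM2l.
  by rewrite ltr_pdivrMr ?mul1r ?ltrDl// addr_gt0.
move: egf_b xt_lt1; apply: filterS2 => t b_cvg xt_lt1.
rewrite -cvg_shiftS/=; rewrite -cvg_shiftS/= in b_cvg.
apply: cvg_geometric_convolution xt_lt1 _ b_cvg => n.
rewrite [LHS]big_nat_recl// [X in _ = X + _]big_nat_recl// -addrA; congr (_ + _).
  by rewrite /a big_nat1 !bin0 subn0 fact0 expr0 !mul1r.
rewrite mulr_sumr -big_split/=; apply: eq_bigr => k _.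
transitivity (a k.+1 / k.+1`!%:R * t ^+ k.+1); first by rewrite mulrA mulrAC.
by rewrite aS exprS -/(a k); ring.
Qed.

(** * The explicit formula *)

Unset Implicit Arguments.

Theorem theorem2p12 (R : realType) (d : measure_display)
    (T : measurableType d) (P : probability T R) (lam : R) (Y : {RV P >-> R})
    (r : R) (lam_neq0 : lam != 0) (r_gt0 : 0 < r)
    (Y_mgf : forall t : R, `|t| < r -> ('M_P Y t < +oo)%E)
    (x : R) (n : nat) :
  prob_degen_derangement lam Y n x =
  \sum_(0 <= j < n.+1) \sum_(0 <= l < j.+1)
    'C(n, j)%:R * degen_stirling1 lam j l * (-1) ^+ (n - j)
    * degen_rising lam 1 l
    * fine ('E_P[fun w : T => degen_rising lam (Y w) (n - j)])%E
    * x ^+ j.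
Proof.
have egf_E := is_egf_expectation_degen_exp lam_neq0 r_gt0 Y_mgf.
rewrite /prob_degen_derangement (egf_coefE (is_egf_geometric_mul x egf_E)).
apply: eq_bigr => j _.
rewrite (expectation_degen_falling lam_neq0 r_gt0 Y_mgf).
rewrite -(sum_stirling1_rising j lam_neq0) mulr_sumr !mulr_suml.
by apply: eq_bigr => l _; rewrite degen_stirling1E//; ring.
Qed.
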